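(* Let $F\subseteq\mathbb{R}^n$ be a self-similar set, the attractor of an iterated function system $\{S_i\}_{i\in\mathcal{I}}$ of contracting similarities of $\mathbb{R}^n$ satisfying the strong separation condition, and let $s=\dim_{\mathrm P}F$. Then there exists $\delta_0>0$ such that for all $\delta\in(0,\delta_0)$, $$0<\mathcal{P}^s(F)=\mathcal{P}^s_0(F)=\mathcal{P}^s_\delta(F)<\infty.$$
   Context: Self-similar set: given a finite collection $\{S_i\}_{i\in\mathcal{I}}$ of similarity maps of $\mathbb{R}^n$ with contraction ratios in $(0,1)$, $F$ is the unique nonempty compact set with $F=\bigcup_{i\in\mathcal{I}}S_i(F)$. The strong separation condition means that the sets $S_i(F)$, $i\in\mathcal{I}$, are pairwise disjoint. Packing measure: for $s\ge0$ and $\delta>0$, $\mathcal{P}^s_\delta(F)$ is the supremum of $\sum_k\mathrm{diam}(U_k)^s$ over all countable collections $\{U_k\}$ of pairwise disjoint closed balls centred in $F$ with $\mathrm{diam}(U_k)\le\delta$ for all $k$. The packing pre-measure is $\mathcal{P}^s_0(F)=\lim_{\delta\to0}\mathcal{P}^s_\delta(F)$, and the packing (outer) measure is $\mathcal{P}^s(F)=\inf\{\sum_i\mathcal{P}^s_0(F_i):F\subseteq\bigcup_iF_i\}$, the infimum being over countable covers. The packing dimension is $\dim_{\mathrm P}F=\inf\{s\ge0:\mathcal{P}^s(F)=0\}$. *)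

(* Defs.v *)
From HB Require Import structures.
From mathcomp Require Import all_boot all_order all_algebra.
From mathcomp Require Import all_classical all_reals all_analysis.
Import Order.TTheory GRing.Theory Num.Theory.
Import numFieldNormedType.Exports.

Set Implicit Arguments.
Unset Strict Implicit.
Unset Printing Implicit Defensive.

Local Open Scope classical_set_scope.
Local Open Scope ring_scope.

(* The library norm on 'rV[R]_n is the sup norm, so the Euclidean distance is
   defined here. Both induce the same topology, hence [compact] below is
   compactness in Euclidean space. *)
Definition edist (R : realType) (n : nat) (x y : 'rV[R]_n) : R :=
  Num.sqrt (\sum_(i < n) (x ord0 i - y ord0 i) ^+ 2).

Definition eball (R : realType) (n : nat) (x : 'rV[R]_n) (r : R) :
    set 'rV[R]_n :=
  [set y | edist x y <= r].

(* Only used for nonempty sets: the value at set0 is -oo. *)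
Definition diam (R : realType) (n : nat) (A : set 'rV[R]_n) : \bar R :=
  ereal_sup [set (edist p.1 p.2)%:E | p in A `*` A].

Definition contracting_similarity (R : realType) (n : nat)
    (f : 'rV[R]_n -> 'rV[R]_n) : Prop :=
  exists2 c : R, 0 < c < 1 & forall x y, edist (f x) (f y) = c * edist x y.

Definition is_attractor (R : realType) (n : nat) (I : finType)
    (S : I -> 'rV[R]_n -> 'rV[R]_n) (F : set 'rV[R]_n) : Prop :=
  [/\ F !=set0, compact F & F = \bigcup_i (S i @` F)].

Definition strong_separation (R : realType) (n : nat) (I : finType)
    (S : I -> 'rV[R]_n -> 'rV[R]_n) (F : set 'rV[R]_n) : Prop :=
  trivIset setT (fun i => S i @` F).

(* A countable collection of pairwise disjoint balls is encoded as a countable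
   set of subsets of the space. Balls have positive radius. *)
Definition is_packing (R : realType) (n : nat) (delta : R)
    (F : set 'rV[R]_n) (U : set (set 'rV[R]_n)) : Prop :=
  [/\ countable U,
      forall A, U A -> exists (x : 'rV[R]_n) (r : R), [/\ F x, 0 < r & A = eball x r],
      forall A, U A -> (diam A <= delta%:E)%E &
      trivIset U id].

(* The convention of [poweR] is 0 to the power 0 = 1; it matters only for n = 0,
   since otherwise balls have positive diameter. *)
Definition packing_delta (R : realType) (n : nat) (s delta : R)
    (F : set 'rV[R]_n) : \bar R :=
  ereal_sup [set (\esum_(A in U) poweR (diam A) s)%E
            | U in [set U | is_packing delta F U]].

(* [packing_delta] is nondecreasing in delta, so the limit always exists. *)
Definition packing_premeasure (R : realType) (n : nat) (s : R)
    (F : set 'rV[R]_n) : \bar R :=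
  lim (packing_delta s delta F @[delta --> 0^'+]).

(* Finite covers are sequences that are eventually set0, on which the
   pre-measure vanishes. *)
Definition packing_measure (R : realType) (n : nat) (s : R)
    (F : set 'rV[R]_n) : \bar R :=
  ereal_inf [set (\sum_(0 <= i <oo) packing_premeasure s (G i))%E
            | G in [set G : nat -> set 'rV[R]_n | F `<=` \bigcup_i G i]].

(* The set of exponents is nonempty, as it contains every s > n, so the real
   [inf] is the true infimum. *)
Definition packing_dim (R : realType) (n : nat) (F : set 'rV[R]_n) : R :=
  inf [set s : R | 0 <= s /\ packing_measure s F = 0%E].

(* Main.v *)
Require Import Defs.
From HB Require Import structures.
From mathcomp Require Import all_boot all_order all_algebra finmap.
From mathcomp Require Import all_classical all_reals all_analysis.
From mathcomp Require Import ring lra.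
Import Order.TTheory GRing.Theory Num.Theory.
Import numFieldNormedType.Exports.
(* all_analysis has its own [edist]. *)
Import Defs.

Set Implicit Arguments.
Unset Strict Implicit.
Unset Printing Implicit Defensive.

Local Open Scope classical_set_scope.
Local Open Scope ring_scope.

(* Let c_i be the ratios and t the solution of sum_i c_i^t = 1. Copying a packing
   of F by small balls into every piece S_i(F) gives a packing of F by smaller
   balls with the same sum of t-th powers, disjointness being guaranteed by the
   gap between the pieces; hence P^t_delta(F) does not depend on delta below
   the gap. Finiteness follows by comparing balls with the natural measure,
   whose value on a ball of radius r is at least a constant times r^t.

   For P^t(F) >= P^t_0(F), let L(E) be the limit, as m grows, of the total mass
   of the cylinders of generation m that meet E. If F is covered by sets G_i,
   compactness gives sum_i L(G_i) >= 1, so it is enough that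
   P^t_0(E) >= b L(E) for every E and every b < P^t_0(F). Fix p. Since the masses
   converge, most of the cylinders of a large generation m that meet E have all
   their descendants p generations below meeting E. In such a cylinder one
   places a copy of a nearly optimal packing of F, with the centres moved
   slightly into E.

   The natural measure and the cylinders are never constructed: all masses are
   defined by recursion on the generation, replacing E by its preimages under
   the S_i. Comparing exponents finally shows that t is the packing dimension. *)

(** * Euclidean balls *)

Section EuclideanDistance.
Context {R : realType} {n : nat}.
Implicit Types (x y z : 'rV[R]_n) (r l : R).

Lemma edist_ge0 x y : 0 <= edist x y.
Proof. exact: sqrtr_ge0. Qed.

Lemma edistC x y : edist x y = edist y x.
Proof.
by congr Num.sqrt; apply: eq_bigr => i _; rewrite -sqrrN opprB.
Qed.

Lemma sqr_edist x y :
  edist x y ^+ 2 = \sum_(i < n) (x ord0 i - y ord0 i) ^+ 2.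
Proof. by rewrite sqr_sqrtr// sumr_ge0// => i _; rewrite sqr_ge0. Qed.

Lemma edistxx x : edist x x = 0.
Proof.
by apply/eqP; rewrite -sqrf_eq0 sqr_edist big1// => i _; rewrite subrr expr0n.
Qed.

Lemma edist_eq0 x y : edist x y = 0 -> x = y.
Proof.
move=> xy0; apply/rowP => i; apply/eqP; rewrite -subr_eq0 -sqrf_eq0.
have : \sum_(j < n) (x ord0 j - y ord0 j) ^+ 2 == 0.
  by rewrite -sqr_edist xy0 expr0n.
rewrite psumr_eq0 => [/allP/(_ i)|j _]; last exact: sqr_ge0.
by rewrite mem_index_enum => /(_ isT).
Qed.

(** Lagrange's identity: the double sum of the squares of [a i * b j - a j * b i] is twice the
    difference of the two sides. *)
Lemma cauchy_schwarz_sum (a b : 'I_n -> R) :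
  (\sum_i a i * b i) ^+ 2 <= (\sum_i a i ^+ 2) * (\sum_i b i ^+ 2).
Proof.
have : 0 <= \sum_i \sum_j (a i * b j - a j * b i) ^+ 2.
  by apply: sumr_ge0 => i _; apply: sumr_ge0 => j _; exact: sqr_ge0.
have -> : \sum_i \sum_j (a i * b j - a j * b i) ^+ 2 =
    \sum_i \sum_j a i ^+ 2 * b j ^+ 2 + \sum_i \sum_j b i ^+ 2 * a j ^+ 2
    - (\sum_i \sum_j (a i * b i) * (a j * b j)) *+ 2.
  rewrite -sumrMnl -big_split -sumrB/=; apply: eq_bigr => i _.
  rewrite -sumrMnl -big_split -sumrB/=; apply: eq_bigr => j _; ring.
rewrite -!big_distrlr/= -expr2 [X in _ + X - _]mulrC -mulr2n -mulrnBl.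
by rewrite pmulrn_lge0// subr_ge0.
Qed.

Lemma edist_triangle y x z : edist x z <= edist x y + edist y z.
Proof.
rewrite -(ler_pXn2r (ltn0Sn 1)) ?nnegrE ?addr_ge0 ?edist_ge0//.
rewrite sqrrD !sqr_edist.
pose a i := x ord0 i - y ord0 i; pose b i := y ord0 i - z ord0 i.
have -> : \sum_(i < n) (x ord0 i - z ord0 i) ^+ 2 =
    \sum_i a i ^+ 2 + (\sum_i a i * b i) *+ 2 + \sum_i b i ^+ 2.
  by rewrite -sumrMnl -!big_split/=; apply: eq_bigr => i _; rewrite /a /b; ring.
rewrite lerD2r lerD2l lerMn2r/=.
apply: le_trans (ler_norm _) _; rewrite -sqrtr_sqr -sqrtrM; last first.
  by apply: sumr_ge0 => i _; exact: sqr_ge0.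
exact: ler_wsqrtr (cauchy_schwarz_sum a b).
Qed.

Lemma edist_quadrilateral x y x' y' :
  edist x y <= edist x x' + edist x' y' + edist y' y.
Proof.
apply: le_trans (edist_triangle y' x y) _.
by rewrite lerD2r edist_triangle.
Qed.

Lemma edist_line x l (v : 'rV[R]_n) : edist x (x + l *: v) = `|l| * edist 0 v.
Proof.
apply/eqP; rewrite -(eqrXn2 (ltn0Sn 1)) ?mulr_ge0 ?edist_ge0//.
rewrite exprMn !sqr_edist real_normK ?num_real// mulr_sumr; apply/eqP.
by apply: eq_bigr => i _; rewrite !mxE; ring.
Qed.

Lemma edist_translate x v w : edist (x + v) (x + w) = edist v w.
Proof.
by congr Num.sqrt; apply: eq_bigr => i _; rewrite !mxE; congr (_ ^+ 2); ring.
Qed.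

Lemma edist_le_norm x y : edist x y <= n%:R * `|x - y|.
Proof.
rewrite -(ler_pXn2r (ltn0Sn 1)) ?nnegrE ?mulr_ge0 ?edist_ge0//.
rewrite sqr_edist exprMn.
apply: (@le_trans _ _ (\sum_(i < n) `|x - y| ^+ 2)).
  apply: ler_sum => i _; rewrite -real_normK ?num_real//.
  rewrite ler_pXn2r ?nnegrE//.
  rewrite /Num.norm/= mx_normrE.
  have -> : x ord0 i - y ord0 i = (x - y) ord0 i by rewrite !mxE.
  exact: (le_bigmax _ (fun ij => `|(x - y) ij.1 ij.2|) (ord0, i)).
rewrite sumr_const card_ord -[leLHS]mulr_natl ler_wpM2r ?sqr_ge0//.
by rewrite -natrX ler_nat; case: (n) => // m; rewrite leq_pmulr.
Qed.

(** Euclidean balls are neighbourhoods for the sup-norm topology; all uses of compactness pass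
    through this. *)
Lemma near_edist x r : 0 < r -> \forall y \near x, edist x y < r.
Proof.
move=> r0; have N0 : 0 < n%:R + 1 :> R by rewrite ltr_wpDl.
have d0 : 0 < r / (n%:R + 1) by rewrite divr_gt0.
apply: filterS (nbhsx_ballx x _ d0) => y; rewrite -ball_normE/= => xy.
apply: le_lt_trans (edist_le_norm _ _) _.
apply: (@le_lt_trans _ _ (n%:R * (r / (n%:R + 1)))).
  by rewrite ler_wpM2l// ltW.
by rewrite mulrCA gtr_pMr// ltr_pdivrMr// mul1r ltrDl.
Qed.

Lemma edist_lipschitz_continuous (f : 'rV[R]_n * 'rV[R]_n -> R) :
  (forall p q, `|f p - f q| <= edist p.1 q.1 + edist p.2 q.2) -> continuous f.
Proof.
move=> lipf p; apply/cvgrPdist_lt => e e0.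
have e20 : 0 < e / 2 by rewrite divr_gt0.
exists ([set y | edist p.1 y < e / 2], [set y | edist p.2 y < e / 2]).
  by split; exact: near_edist.
move=> q [/= pq1 pq2]; apply: le_lt_trans (lipf p q) _.
by rewrite (splitr e) ltrD.
Qed.

Lemma open_edist_nbhs (E : set 'rV[R]_n) (e : R) :
  open [set x | exists2 y, E y & edist x y < e].
Proof.
rewrite openE => x [y Ey xy].
have d0 : 0 < e - edist x y by rewrite subr_gt0.
apply: filterS (near_edist x d0) => z /= xz; exists y => //.
apply: le_lt_trans (edist_triangle x z y) _.
by rewrite (edistC z) -ltrBrDr.
Qed.

(** The point dividing the segment from [x] to [y] in the ratio [r : r'] lies in both balls.
    Disjointness thus becomes a strict inequality on centres and radii. *)
Lemma eballI_neq0 x y (r r' : R) : 0 < r -> 0 < r' ->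
  (eball x r `&` eball y r' !=set0) <-> edist x y <= r + r'.
Proof.
move=> r0 r'0; have rr0 := addr_gt0 r0 r'0; split=> [[z [xz yz]]|xy].
  apply: le_trans (edist_triangle z x y) _.
  by apply: lerD => //; rewrite edistC.
have xyE : edist x y = edist 0 (y - x).
  by rewrite -(edist_translate x 0) addr0 addrC subrK.
exists (x + (r / (r + r')) *: (y - x)); split; rewrite /eball/=.
  rewrite edist_line -xyE ger0_norm; last by rewrite divr_ge0// ltW.
  by rewrite mulrAC ler_pdivrMr// ler_wpM2l// ltW.
have -> : x + (r / (r + r')) *: (y - x) = y + (- (r' / (r + r'))) *: (y - x).
  have -> : - (r' / (r + r')) = r / (r + r') - 1 by field; rewrite gt_eqF.
  by apply/rowP => i; rewrite !mxE; ring.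
rewrite edist_line -xyE normrN ger0_norm; last by rewrite divr_ge0// ltW.
by rewrite mulrAC ler_pdivrMr// ler_wpM2l// ltW.
Qed.

(** The boolean factor covers dimension 0, where a ball is a single point. *)
Definition ball_diam r : R := (0 < n)%N%:R * 2 * r.

Lemma ball_diam_ge0 r : 0 <= r -> 0 <= ball_diam r.
Proof. by move=> r0; rewrite !mulr_ge0. Qed.

Lemma ball_diam_le r : 0 <= r -> ball_diam r <= 2 * r.
Proof.
by move=> r0; rewrite ler_wpM2r// ler_piMl//; case: (0 < n)%N.
Qed.

Lemma ball_diamZ l r : ball_diam (l * r) = l * ball_diam r.
Proof. by rewrite /ball_diam; ring. Qed.

Lemma diam_eball x r : 0 < r -> diam (eball x r) = (ball_diam r)%:E.
Proof.
move=> r0; apply/eqP; rewrite eq_le; apply/andP; split.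
  apply/ereal_supP => _ [[y z] [/= xy xz] <-]; rewrite lee_fin /ball_diam.
  case: (posnP n) => n0.
    rewrite !mul0r /edist big1 ?sqrtr0// => i _.
    by have := ltn_ord i; rewrite [X in (_ < X)%N]n0.
  rewrite mul1r; apply: le_trans (edist_triangle x y z) _.
  by move: xy xz; rewrite /eball/= (edistC y x); lra.
apply: ereal_sup_ubound; rewrite /ball_diam.
case: (posnP n) => n0.
  exists (x, x); first by split; rewrite /eball/= edistxx ltW.
  by rewrite /= edistxx !mul0r.
pose v : 'rV[R]_n := delta_mx ord0 (Ordinal n0).
have v1 : edist 0 v = 1.
  rewrite /edist (bigD1 (Ordinal n0))//= big1 ?addr0 => [|i /negPf iN].
    by rewrite !mxE !eqxx sub0r sqrrN expr1n sqrtr1.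
  by rewrite !mxE eqxx iN subr0 expr0n.
exists (x + (- r) *: v, x + r *: v) => /=.
  by split; rewrite /eball/= edist_line v1 mulr1 ?normrN gtr0_norm.
have -> : x + r *: v = x + (- r) *: v + (r + r) *: v.
  by apply/rowP => i; rewrite !mxE; ring.
by rewrite edist_line v1 ger0_norm ?addr_ge0 ?ltW//; congr EFin; ring.
Qed.

End EuclideanDistance.

Arguments ball_diam {R} n r.

(** * Finite packings *)

(** Centres and radii are kept as data, since a ball as a set need not determine them and copying a
    packing acts on them. *)
Record ball_family (R : realType) (n : nat) := BallFamily {
  index : finType;
  center : index -> 'rV[R]_n;
  radius : index -> R }.

Section FinitePackings.
Context {R : realType} {n : nat}.
Implicit Types (E F : set 'rV[R]_n) (B : ball_family R n) (s rho delta : R).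

Definition finite_packing rho E B : Prop :=
  (forall j : index B, [/\ E (center j), 0 < radius j & radius j <= rho]) /\
  (forall j k : index B,
    j != k -> radius j + radius k < edist (center j) (center k)).

Definition packing_sum s B : R := \sum_(j : index B) ball_diam n (radius j) `^ s.

Lemma packing_sum_ge0 s B : 0 <= packing_sum s B.
Proof. by apply: sumr_ge0 => j _; exact: powR_ge0. Qed.

(** Together with [packing_delta_le] this makes [packing_delta] a supremum over finite families, so
    that countable packings never appear again. *)
Lemma packing_sum_le_delta s delta E B : 0 < delta ->
  finite_packing (delta / 2) E B -> ((packing_sum s B)%:E <= packing_delta s delta E)%E.
Proof.
move=> d0 [Bball Bsep].
pose f (j : index B) := eball (center j) (radius j).
have ftriv : trivIset setT f.
  move=> j k _ _; have [_ rj0 _] := Bball j; have [_ rk0 _] := Bball k.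
  rewrite (eballI_neq0 _ _ rj0 rk0) leNgt => /negP jk.
  by apply/eqP/negPn/negP => /Bsep.
apply: ereal_sup_ubound; exists (range f).
  split.
  - by apply/finite_set_countable/finite_image/finite_finset.
  - by move=> _ [j _ <-]; have [? ? _] := Bball j; exists (center j), (radius j).
  - move=> _ [j _ <-]; have [_ rj0 rj] := Bball j.
    rewrite /f diam_eball// lee_fin (le_trans (ball_diam_le (ltW rj0)))//.
    by rewrite mulrC -ler_pdivlMr.
  - exact: trivIset_image.
rewrite esum_image; last first.
  move=> j k _ _ fjk; apply: ftriv => //; rewrite -fjk setIid.
  by have [_ rj0 _] := Bball j; exists (center j); rewrite /f /eball/= edistxx ltW.
rewrite esum_fset; [|exact: finite_finset|by move=> *; exact: poweR_ge0].
rewrite (fsbigE (enum (index B))) ?enum_uniq//=; last first.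
  by move=> j _; rewrite mem_enum.
rewrite big_enum_cond/= /packing_sum -sumEFin; apply: eq_big => j.
  by rewrite in_setT.
move=> _; have [_ rj0 _] := Bball j.
by rewrite /f diam_eball// poweR_EFin.
Qed.

(** In positive dimension [r] itself works. In dimension 0 every ball is the whole space, so its
    radius can be chosen freely. *)
Lemma eball_shrink delta (x : 'rV[R]_n) (r : R) :
  0 < delta -> 0 < r -> (diam (eball x r) <= delta%:E)%E ->
  exists r', [/\ 0 < r', r' <= delta / 2 & eball x r' = eball x r].
Proof.
move=> d0 r0; rewrite diam_eball// lee_fin /ball_diam.
case: (posnP n) => n0.
  move=> _; have dxy0 y : edist x y = 0.
    rewrite /edist big1 ?sqrtr0// => i _.
    by have := ltn_ord i; rewrite [X in (_ < X)%N]n0.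
  exists (delta / 2); split=> //; first by rewrite divr_gt0.
  by apply/seteqP; split => y _; rewrite /eball/= dxy0 ltW// divr_gt0.
by rewrite mul1r => rd; exists r; split=> //; rewrite ler_pdivlMr// mulrC.
Qed.

(** The sum over a countable packing is the supremum of its finite subsums, and each finite subset
    [A] of the packing is itself a finite packing. *)
Lemma packing_delta_le s delta E (v : \bar R) : 0 < delta ->
  (forall B, finite_packing (delta / 2) E B -> ((packing_sum s B)%:E <= v)%E) ->
  (packing_delta s delta E <= v)%E.
Proof.
move=> d0 Bv; apply/ereal_supP => _ [U [_ Uball Udiam Utriv] <-].
apply/ereal_supP => _ [A [Afin AU] <-].
have /choice[g gP] : forall X : set 'rV[R]_n, exists p : 'rV[R]_n * R, U X ->
    [/\ E p.1, 0 < p.2, p.2 <= delta / 2 & eball p.1 p.2 = X].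
  move=> X; have [UX|nUX] := pselect (U X); last by exists (0, 0).
  have [x [r [Ex r0 XE]]] := Uball X UX.
  have := Udiam X UX; rewrite XE => /(eball_shrink d0 r0)[r' [r'0 r'd r'E]].
  by exists (x, r').
pose B := @BallFamily R n (fset_set A) (fun X => (g (val X)).1)
  (fun X => (g (val X)).2).
have UB (X : fset_set A) : U (val X).
  by apply: AU; apply/set_mem; rewrite -(in_fset_set Afin) fsvalP.
have -> : (\sum_(X \in A) (diam X `^ s)%E)%R = (packing_sum s B)%:E.
  rewrite fsbig_finite//= big_seq_fsetE/= /packing_sum -sumEFin.
  apply: eq_bigr => X _; have [_ r0 _ {1}<-] := gP _ (UB X).
  by rewrite diam_eball// poweR_EFin.
apply: Bv; split => [X|X Y XY] /=.
  by have [] := gP _ (UB X).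
have [_ rX0 _ XE] := gP _ (UB X); have [_ rY0 _ YE] := gP _ (UB Y).
rewrite ltNge; apply/negP; rewrite -(eballI_neq0 _ _ rX0 rY0) XE YE => XY0.
by move/eqP: XY; apply; apply: val_inj; exact: Utriv XY0.
Qed.

(** * Order properties of the pre-measure and the measure *)

Lemma finite_packing_mono rho rho' E F B :
  rho <= rho' -> E `<=` F -> finite_packing rho E B -> finite_packing rho' F B.
Proof.
move=> rr' EF [Bball Bsep]; split=> // j; have [? ? jrho] := Bball j.
by split; [exact: EF| |exact: le_trans jrho rr'].
Qed.

Lemma packing_delta_mono s delta delta' E F : 0 < delta -> delta <= delta' ->
  E `<=` F -> (packing_delta s delta E <= packing_delta s delta' F)%E.
Proof.
move=> d0 dd' EF; apply: packing_delta_le => // B BE.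
apply: packing_sum_le_delta; first exact: lt_le_trans dd'.
by apply: finite_packing_mono BE => //; rewrite ler_wpM2r.
Qed.

Lemma finite_packing_void rho E :
  finite_packing rho E (@BallFamily R n void (of_void _) (of_void _)).
Proof. by split; case. Qed.

Lemma packing_delta_ge0 s delta E : 0 < delta -> (0 <= packing_delta s delta E)%E.
Proof.
move=> d0; apply: le_trans (packing_sum_le_delta s d0 (finite_packing_void _ _)).
by rewrite lee_fin packing_sum_ge0.
Qed.

Lemma packing_premeasureE s E : packing_premeasure s E =
  ereal_inf [set packing_delta s delta E | delta in [set delta | 0 < delta]].
Proof.
rewrite /packing_premeasure (cvg_lim _ (nondecreasing_at_right_cvge +oo%O _ _))//.
  by congr ereal_inf; congr image; apply/seteqP; split => x /=; rewrite in_itv/= andbT.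
move=> x y /=; rewrite in_itv/= andbT => x0 _ xy.
exact: packing_delta_mono.
Qed.

Lemma packing_premeasure_le s delta E : 0 < delta ->
  (packing_premeasure s E <= packing_delta s delta E)%E.
Proof. by move=> d0; rewrite packing_premeasureE; apply: ereal_inf_lbound; exists delta. Qed.

Lemma le_packing_premeasure s E (v : \bar R) :
  (forall delta, 0 < delta -> (v <= packing_delta s delta E)%E) ->
  (v <= packing_premeasure s E)%E.
Proof.
by move=> vle; rewrite packing_premeasureE; apply/ereal_infP => _ [d d0 <-]; exact: vle.
Qed.

Lemma packing_premeasure_ge0 s E : (0 <= packing_premeasure s E)%E.
Proof. by apply: le_packing_premeasure => d; exact: packing_delta_ge0. Qed.

Lemma packing_premeasure_set0 s : packing_premeasure s (@set0 'rV[R]_n) = 0%E.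
Proof.
apply/eqP; rewrite eq_le packing_premeasure_ge0 andbT.
apply: le_trans (packing_premeasure_le _ _ ltr01) _.
apply: packing_delta_le => // B [Bball _].
by rewrite lee_fin /packing_sum big1// => j; have [] := Bball j.
Qed.

Lemma packing_measure_ge0 s E : (0 <= packing_measure s E)%E.
Proof.
apply/ereal_infP => _ [G _ <-]; apply: nneseries_ge0 => i _ _.
exact: packing_premeasure_ge0.
Qed.

Lemma packing_measure_le s E : (packing_measure s E <= packing_premeasure s E)%E.
Proof.
pose G i : set 'rV[R]_n := if i == 0%N then E else set0.
apply: ereal_inf_lbound; exists G; first by move=> x Ex; exists 0%N.
rewrite nneseries_recl//; last by move=> i _; exact: packing_premeasure_ge0.
rewrite eseries0 ?adde0// => -[|i]// _ _; exact: packing_premeasure_set0.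
Qed.

Lemma packing_measure_mono s t E :
  (forall G : set 'rV[R]_n, (packing_premeasure s G <= packing_premeasure t G)%E) ->
  (packing_measure s E <= packing_measure t E)%E.
Proof.
move=> st; apply/ereal_infP => _ [G EG <-].
apply: (@le_trans _ _ (\sum_(0 <= i <oo) packing_premeasure s (G i))%E).
  by apply: ereal_inf_lbound; exists G.
apply: lee_nneseries => i *; first exact: packing_premeasure_ge0.
exact: st.
Qed.

(** At scales below 1 all diameters are at most 1, so their powers decrease as the exponent
    grows. *)
Lemma packing_premeasure_antimono s t E : 0 <= t -> t <= s ->
  (packing_premeasure s E <= packing_premeasure t E)%E.
Proof.
move=> t0 ts; apply: le_packing_premeasure => d d0.
have m0 : 0 < Num.min d 1 by rewrite lt_min d0 ltr01.
apply: le_trans (packing_premeasure_le _ _ m0) _.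
apply: packing_delta_le => // B BE.
apply: (@le_trans _ _ (packing_sum t B)%:E); last first.
  apply: packing_sum_le_delta => //; apply: finite_packing_mono BE => //.
  by rewrite ler_pM2r// ge_min lexx.
rewrite lee_fin; apply: ler_sum => j _.
have [_ r0 rm] := BE.1 j.
have := ball_diam_ge0 (n := n) (ltW r0); rewrite le_eqVlt => /orP[/eqP<-|b0].
  (* A zero diameter: since 0 to the power 0 is 1, [s = 0] is treated apart, and it forces
     [t = 0]. *)
  have [s0|s0] := eqVneq s 0; last by rewrite powR0// powR_ge0.
  by have -> : t = s by apply/eqP; rewrite eq_le ts s0.
have b1 : ball_diam n (radius j) <= 1.
  apply: le_trans (ball_diam_le (ltW r0)) _; rewrite mulrC -ler_pdivlMr//.
  by apply: le_trans rm _; rewrite ler_pM2r// ge_min lexx orbT.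
by apply: ger_powR => //; rewrite b0.
Qed.

End FinitePackings.

(** * Self-similar sets with a gap *)

Lemma finite_pos_lower_bound (R : realType) (J : finType) (e : J -> R) :
  (forall j, 0 < e j) -> exists2 d, 0 < d & forall j, d <= e j.
Proof.
move=> e0; exists (\big[Num.min/1]_j e j).
  by apply: lt_bigmin => // j _; exact: e0.
by move=> j; exact: bigmin_le.
Qed.

Lemma expr_mul_small (R : realType) (q a e : R) : 0 <= q < 1 -> 0 < e ->
  exists m, q ^+ m * a <= e.
Proof.
move=> /andP[q0 q1] e0.
have a0 : 0 < `|a| + 1 by rewrite ltr_wpDl.
have : (fun m => q ^+ m) @ \oo --> (0 : R) by apply: cvg_expr; rewrite ger0_norm.
move=> /cvgrPdist_lt /(_ (e / (`|a| + 1))); rewrite divr_gt0// => /(_ isT)[m _ /(_ m)].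
rewrite /= leqnn sub0r normrN ger0_norm ?exprn_ge0// => /(_ isT) qm; exists m.
apply: (@le_trans _ _ (q ^+ m * (`|a| + 1))).
  by rewrite ler_wpM2l ?exprn_ge0// (le_trans (ler_norm _))// lerDl.
by rewrite -ler_pdivlMr// ltW.
Qed.

Section SeparatedIFS.
Context {R : realType} {n : nat} {I : finType}.
Context {S : I -> 'rV[R]_n -> 'rV[R]_n} {F : set 'rV[R]_n}.
Context {c : I -> R} {cmin cmax gap D t : R}.
Context (cmin0 : 0 < cmin) (cmin_le : forall i, cmin <= c i)
  (le_cmax : forall i, c i <= cmax) (cmax1 : cmax < 1).
Context (SE : forall i x y, edist (S i x) (S i y) = c i * edist x y).
Context (F0 : F !=set0) (FE : F = \bigcup_i (S i @` F)).
Context (gap0 : 0 < gap)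
  (gapP : forall i j x y, F x -> F y -> i != j -> gap <= edist (S i x) (S j y)).
Context (gapD : gap <= D) (diamF : forall x y, F x -> F y -> edist x y <= D).
Context (t0 : 0 <= t) (sumct : \sum_i c i `^ t = 1).
Implicit Types (E : set 'rV[R]_n) (x y : 'rV[R]_n) (m p : nat).

Let w i := c i `^ t.
Let wmin := cmin `^ t.

Let c_gt0 i : 0 < c i. Proof. exact: lt_le_trans (cmin_le i). Qed.
Let c_lt1 i : c i < 1. Proof. exact: le_lt_trans (le_cmax i) _. Qed.
Let w_ge0 i : 0 <= w i. Proof. exact: powR_ge0. Qed.
Let w_gt0 i : 0 < w i. Proof. exact: powR_gt0. Qed.
Let wmin_gt0 : 0 < wmin. Proof. exact: powR_gt0. Qed.
Let wmin_le i : wmin <= w i.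
Proof. by rewrite ge0_ler_powR// nnegrE ltW. Qed.
Let D_gt0 : 0 < D. Proof. exact: lt_le_trans gapD. Qed.

Let index_inhabited : I.
Proof.
have /cid[x] := F0; rewrite FE => /cid2[i _ _]; exact: i.
Qed.

Let cmax_gt0 : 0 < cmax.
Proof. exact: lt_le_trans (c_gt0 index_inhabited) (le_cmax _). Qed.

Let SF i x : F x -> F (S i x).
Proof. by move=> Fx; rewrite FE; exists i => //; exists x. Qed.

Let F_split x : F x -> exists i y, F y /\ x = S i y.
Proof. by rewrite {1}FE => -[i _ [y Fy <-]]; exists i, y. Qed.

(* [mass m E] is the mass, for the natural self-similar measure on [F], of the
   union of the cylinders of generation [m] that meet [E]. *)
Fixpoint mass m E : R :=
  if m is k.+1 then \sum_i w i * mass k (S i @^-1` E)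
  else `[< F `&` E !=set0 >]%:R.

Lemma mass_ge0 m E : 0 <= mass m E.
Proof.
elim: m E => [|m IH] E /=; first exact: ler0n.
by apply: sumr_ge0 => i _; rewrite mulr_ge0.
Qed.

Lemma mass_le1 m E : mass m E <= 1.
Proof.
elim: m E => [|m IH] E /=; first by rewrite lern1 leq_b1.
by rewrite -sumct; apply: ler_sum => i _; rewrite ler_piMr.
Qed.

Lemma mass_mono m E E' : F `&` E `<=` E' -> mass m E <= mass m E'.
Proof.
elim: m E E' => [|m IH] E E' EE' /=.
  rewrite ler_nat; case: asboolP => // -[x [Fx Ex]].
  case: asboolP => // nE; exfalso; apply: nE; exists x; split=> //; exact: EE'.
apply: ler_sum => i _; rewrite ler_wpM2l//; apply: IH => x [Fx Ex].
by apply: EE'; split=> //; exact: SF.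
Qed.

Lemma mass_full m E : F `<=` E -> mass m E = 1.
Proof.
elim: m E => [|m IH] E FsubE /=.
  case: asboolP => // nE; exfalso; apply: nE.
  by have [x Fx] := F0; exists x; split=> //; exact: FsubE.
rewrite -sumct; apply: eq_bigr => i _; rewrite IH ?mulr1// => x Fx.
exact/FsubE/SF.
Qed.

Lemma mass_disjoint m E : F `&` E = set0 -> mass m E = 0.
Proof.
elim: m E => [|m IH] E FE0 /=.
  by case: asboolP => // -[x]; rewrite FE0.
rewrite big1// => i _; rewrite IH ?mulr0// -subset0 => x [Fx Ex].
have : (F `&` E) (S i x) by split; [exact: SF|exact: Ex].
by rewrite FE0.
Qed.

Lemma massU m E E' : mass m (E `|` E') <= mass m E + mass m E'.
Proof.
elim: m E E' => [|m IH] E E' /=.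
  rewrite -natrD ler_nat; case: asboolP => // -[x [Fx [Ex|Ex]]].
    by rewrite [X in (_ <= nat_of_bool X + _)%N]asboolT ?leq_addr//; exists x.
  by rewrite [X in (_ <= _ + nat_of_bool X)%N]asboolT ?leq_addl//; exists x.
rewrite -big_split/=; apply: ler_sum => i _.
by rewrite -mulrDr ler_wpM2l// preimage_setU.
Qed.

Lemma mass_bigcup m N (G : nat -> set 'rV[R]_n) :
  mass m (\bigcup_(i in `I_N) G i) <= \sum_(i < N) mass m (G i).
Proof.
elim: N => [|N IH].
  by rewrite big_ord0 II0 bigcup_set0 mass_disjoint// setI0.
rewrite IIS bigcup_setU bigcup_set1 big_ord_recr/=.
by apply: le_trans (massU _ _ _) _; rewrite lerD2r.
Qed.

(** A cylinder that meets [E] is replaced by those of its children that do, and the weights of all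
    its children add up to its own. *)
Lemma mass_anti m m' E : (m <= m')%N -> mass m' E <= mass m E.
Proof.
have succ k E' : mass k.+1 E' <= mass k E'.
  elim: k E' => [|k IH] E'; last first.
    apply: ler_sum => i _; apply: ler_wpM2l => //; exact: IH.
  have [F0E|nFE] := pselect (F `&` E' !=set0).
    by rewrite [leRHS]/= asboolT//; exact: mass_le1.
  have E0 : F `&` E' = set0 by apply/eqP/negPn/negP => /set0P.
  by rewrite !mass_disjoint.
move=> /subnK <-; elim: (m' - m)%N => [|k IH] //.
by rewrite addSn (le_trans (succ _ _)).
Qed.

(** A single cylinder of generation [p] that misses [E] already costs at least [wmin ^+ p]. *)
Lemma mass_gap p E : mass p E = 1 \/ mass p E <= 1 - wmin ^+ p.
Proof.
elim: p E => [|p IH] E /=.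
  by rewrite expr0 subrr; case: asboolP; [left|right].
have [/forallP full|/forallPn[i ni]] :=
    boolP [forall i, mass p (S i @^-1` E) == 1].
  by left; rewrite -sumct; apply: eq_bigr => i _; rewrite (eqP (full i)) mulr1.
right; rewrite -sumct (bigD1 i)//= (bigD1 (F := fun i => c i `^ t) i)//=.
have [mi|mi] := IH (S i @^-1` E); first by rewrite mi eqxx in ni.
rewrite -[leRHS]addrAC; apply: lerD; last first.
  by apply: ler_sum => j _; rewrite ler_piMr// mass_le1.
apply: le_trans (ler_wpM2l (w_ge0 i) mi) _.
rewrite mulrBr mulr1 lerD2l lerN2 exprS ler_wpM2r//.
by rewrite exprn_ge0// ltW.
Qed.

(** All weights are positive, so full mass means that every cylinder of generation [p] meets [E];
    these cylinders have diameter at most [cmax ^+ p * D]. *)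
Lemma mass1_dense p E x : mass p E = 1 -> F x ->
  exists y, [/\ F y, E y & edist x y <= cmax ^+ p * D].
Proof.
elim: p E x => [|p IH] E x /=.
  case: asboolP => [[y [Fy Ey]] _ Fx|_ /esym/eqP]; last by rewrite oner_eq0.
  by exists y; split=> //; rewrite expr0 mul1r diamF.
move=> mE /F_split[i [x' [Fx' ->]]].
have mi : mass p (S i @^-1` E) = 1.
  have : \sum_i w i * (1 - mass p (S i @^-1` E)) == 0.
    under eq_bigr do rewrite mulrBr mulr1.
    by rewrite sumrB mE sumct subrr.
  rewrite psumr_eq0 => [/allP/(_ i)|j _]; last first.
    by rewrite mulr_ge0// subr_ge0 mass_le1.
  by rewrite mem_index_enum => /(_ isT)/=; rewrite mulf_eq0 gt_eqF//= subr_eq0 => /eqP.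
have [y [Fy Ey xy]] := IH _ _ mi Fx'.
exists (S i y); split=> //; first exact: SF.
by rewrite SE exprS -mulrA ler_pM ?edist_ge0 ?(ltW (c_gt0 i)).
Qed.

(** Distinct cylinders of generation [m] are a positive distance apart, so a thin neighbourhood of
    [F] intersected with [E] reaches no new one. *)
Lemma mass_nbhd m E : exists2 e, 0 < e &
  mass m [set x | exists2 y, (F `&` E) y & edist x y < e] <= mass m E.
Proof.
elim: m E => [|m IH] E.
  exists 1 => //; have [F0E|nFE] := pselect (F `&` E !=set0).
    by rewrite [leRHS]/= asboolT//; exact: mass_le1.
  rewrite [leLHS]mass_disjoint ?mass_ge0// -subset0 => x [_ [y FEy _]].
  by apply: nFE; exists y.
have /choice[e eP] : forall i, exists e, 0 < e /\ mass m [set x | exists2 y,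
    (F `&` (S i @^-1` E)) y & edist x y < e] <= mass m (S i @^-1` E).
  by move=> i; have [e e0 me] := IH (S i @^-1` E); exists e.
have [d d0 dle] : exists2 d, 0 < d & forall i, d <= c i * e i.
  by apply: finite_pos_lower_bound => i; have [? _] := eP i; rewrite mulr_gt0.
(* Below [gap] both points lie in the same piece [i]; there [d] ensures that pulling back by [S i]
   leaves a distance below [e i]. *)
exists (Num.min d gap); first by rewrite lt_min d0.
apply: ler_sum => i _; rewrite ler_wpM2l//.
have [_] := eP i; apply: le_trans; apply: mass_mono => x [Fx] /= [y [Fy Ey]].
rewrite lt_min => /andP[xyd xygap].
have [j [y' [Fy' yE]]] := F_split Fy; move: Ey xyd xygap; rewrite yE => Ey xyd xygap.
have [ij|ij] := eqVneq i j; last by move: xygap; rewrite ltNge gapP.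
subst j; exists y' => //; rewrite -(ltr_pM2l (c_gt0 i)) -SE.
exact: lt_le_trans (dle i).
Qed.

(** A cylinder of generation [m] has diameter at most [cmax ^+ m * D], so it meets at most one of
    the sets and is counted at most once. *)
Lemma sum_mass_separated m (J : finType) (E : J -> set 'rV[R]_n) :
  (forall j k x y, j != k -> F x -> F y -> E j x -> E k y -> cmax ^+ m * D < edist x y) ->
  \sum_j mass m (E j) <= 1.
Proof.
elim: m E => [|m IH] E sepE.
  have [/existsP[j]|/existsPn none] := boolP [exists j : J, `[< F `&` E j !=set0 >]].
    move=> /asboolP[x [Fx Ex]]; rewrite (bigD1 j)//= big1 ?addr0.
      by rewrite lern1 leq_b1.
    move=> k kj; case: asboolP => // -[y [Fy Ey]].
    have := sepE k j y x kj Fy Fx Ey Ex.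
    by rewrite expr0 mul1r ltNge diamF.
  by rewrite big1// => j _; rewrite /= (negPf (none j)).
rewrite /= exchange_big/= -sumct; apply: ler_sum => i _.
rewrite -mulr_sumr ler_piMr//; apply: IH => j k x y jk Fx Fy Ex Ey.
have := sepE j k _ _ jk (SF i Fx) (SF i Fy) Ex Ey.
rewrite SE exprS -mulrA => lt; rewrite -(ltr_pM2l (c_gt0 i)).
by apply: le_lt_trans lt; rewrite ler_wpM2r// mulr_ge0 ?exprn_ge0// ltW.
Qed.

(** Lower regularity of the natural measure: the ball is pulled back through the pieces containing
    its centre until it covers a whole piece or the generations run out. *)
Lemma mass_ball_ge m x r : F x -> 0 < r -> r <= D ->
  (cmin / D * r) `^ t <= mass m (eball x r).
Proof.
have cminD_gt0 : 0 < cmin / D by rewrite divr_gt0.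
elim: m x r => [|m IH] x r Fx r0 rD.
all: have K0 : 0 < cmin / D * r by rewrite mulr_gt0.
(* This settles both ends of the recursion: the base is below 1 at generation 0, and below [c i]
   when the ball covers piece [i], of mass [w i]. *)
all: have Kle i : cmin / D * r <= c i.
all: try by apply: le_trans (cmin_le i); rewrite -mulrA ger_pMr// mulrC ler_pdivrMr// mul1r.
  rewrite [leRHS]/= asboolT; last first.
    by exists x; split=> //; rewrite /eball/= edistxx ltW.
  rewrite -(powRr0 (cmin / D * r)) ger_powR// K0/=.
  by rewrite (le_trans (Kle index_inhabited))// ltW.
have [i [y [Fy xE]]] := F_split Fx.
rewrite /= (bigD1 i)//=; apply: (@le_trans _ _ (w i * mass m (S i @^-1` eball x r))).
  have rci0 : 0 < r / c i by rewrite divr_gt0.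
  have [rle|rgt] := leP (r / c i) D.
    have -> : S i @^-1` eball x r = eball y (r / c i).
      by apply/seteqP; split => z; rewrite /eball/= xE SE ler_pdivlMr// mulrC.
    have -> : (cmin / D * r) `^ t = w i * (cmin / D * (r / c i)) `^ t.
      rewrite -powRM ?(ltW (c_gt0 i))//; last by rewrite ltW// mulr_gt0.
      by congr (_ `^ _); field; rewrite !gt_eqF.
    by rewrite ler_wpM2l// IH.
  rewrite mass_full => [|z Fz]; last first.
    rewrite /preimage/eball/= xE SE mulrC -ler_pdivlMr//.
    by apply: le_trans (ltW rgt); rewrite diamF.
  by rewrite mulr1 ge0_ler_powR// nnegrE ltW.
by rewrite lerDl sumr_ge0// => j _; rewrite mulr_ge0// mass_ge0.
Qed.

(** * Limit of the masses along the generations *)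

Definition lim_mass E := inf (range (mass^~ E)).

Let has_lbound_mass E : has_lbound (range (mass^~ E)).
Proof. by exists 0 => _ [m _ <-]; exact: mass_ge0. Qed.

Lemma lim_mass_le m E : lim_mass E <= mass m E.
Proof. by apply: ge_inf => //; exists m. Qed.

Lemma lim_mass_adherent E e : 0 < e -> exists m, mass m E < lim_mass E + e.
Proof.
move=> e0; have [] := @inf_adherent _ (range (mass^~ E)) e e0.
  by split=> //; exists (mass 0 E), 0%N.
by move=> _ [m _ <-] me; exists m.
Qed.

(* The cylinders of generation [m] that meet [G i] contain a neighbourhood of
   [G i] in [F], so a countable cover can be reduced to a finite one. *)
Lemma lim_mass_cover (G : nat -> set 'rV[R]_n) e : compact F ->
  F `<=` \bigcup_i G i -> 0 < e ->
  exists N, 1 - e <= \sum_(i < N) lim_mass (G i).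
Proof.
move=> Fcpt FG e0.
have /choice[m mP] : forall i, exists m, mass m (G i) < lim_mass (G i) + e / (2 ^+ i.+1).
  by move=> i; apply: lim_mass_adherent; rewrite divr_gt0// exprn_gt0.
have /choice[d dP] : forall i, exists d, 0 < d /\ mass (m i)
    [set x | exists2 y, (F `&` G i) y & edist x y < d] <= mass (m i) (G i).
  by move=> i; have [d d0 md] := mass_nbhd (m i) (G i); exists d.
pose U i := [set x | exists2 y, (F `&` G i) y & edist x y < d i].
move: Fcpt; rewrite compact_cover => /(_ nat setT U)[||A _ FA].
- by move=> i _; exact: open_edist_nbhs.
- move=> x Fx; have [i _ Gix] := FG x Fx; exists i => //.
  by exists x => //; rewrite edistxx; have [] := dP i.
pose N := (\max_(i <- A) i).+1; exists N.
have FU : F `<=` \bigcup_(i in `I_N) U i.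
  move=> x /FA[i /= iA Uix]; exists i => //=.
  by rewrite /N ltnS (leq_bigmax_seq (F := id)).
(* A common generation for the finitely many sets; passing from [m i] to [M] only lowers the
   masses. *)
pose M := (\max_(i < N) m i)%N.
have : 1 <= \sum_(i < N) mass M (U i) by rewrite -(mass_full M FU); exact: mass_bigcup.
have : \sum_(i < N) mass M (U i) <= \sum_(i < N) lim_mass (G i) + \sum_(i < N) e / 2 ^+ i.+1.
  rewrite -big_split/=; apply: ler_sum => i _; apply: le_trans (ltW (mP i)).
  have [_] := dP i; apply: le_trans; apply: mass_anti.
  exact: (leq_bigmax i (F := fun i : 'I_N => m i)).
have : \sum_(i < N) e / 2 ^+ i.+1 <= e.
  suff -> : \sum_(i < N) e / 2 ^+ i.+1 = e - e / 2 ^+ N.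
    by rewrite gerBl divr_ge0 ?exprn_ge0// ltW.
  elim: (N) => [|k IH]; first by rewrite big_ord0 expr0 divr1 subrr.
  by rewrite big_ord_recr/= IH exprS; field; rewrite expf_neq0.
lra.
Qed.

(* Mass of the cylinders of generation [m] all of whose descendants [p]
   generations below meet [E]. *)
Fixpoint full_mass p m E : R :=
  if m is k.+1 then \sum_i w i * full_mass p k (S i @^-1` E)
  else (mass p E == 1)%:R.

(** By [mass_gap], a cylinder that meets [E] without being full loses at least the fraction
    [wmin ^+ p] of its weight within [p] generations. *)
Lemma full_mass_defect p m E :
  wmin ^+ p * (mass m E - full_mass p m E) <= mass m E - mass (m + p) E.
Proof.
elim: m E => [|m IH] E; last first.
  rewrite addSn /= -!sumrB mulr_sumr; apply: ler_sum => i _.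
  by rewrite -!mulrBr mulrCA ler_wpM2l.
rewrite add0n [full_mass _ _ _]/=.
have [pE|pE] := eqVneq (mass p E) 1.
  have := mass_anti E (leq0n p); have := mass_le1 0 E; rewrite pE => ? ?.
  have -> : mass 0 E = 1 by apply/eqP; rewrite eq_le; apply/andP.
  by rewrite !subrr mulr0.
have [/eqP|gap_p] := mass_gap p E; first by rewrite (negPf pE).
have [F0E|nFE] := pselect (F `&` E !=set0).
  have -> : mass 0 E = 1 by rewrite /= asboolT.
  by rewrite subr0 mulr1; lra.
have E0 : F `&` E = set0 by apply/eqP/negPn/negP => /set0P.
by rewrite !mass_disjoint// subrr mulr0.
Qed.

(** Once [mass m E] is within [wmin ^+ p * e] of its limit, [full_mass_defect] leaves at most [e] to
    the cylinders that are not full. *)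
Lemma full_mass_lim p E e : 0 < e ->
  exists m0, forall m, (m0 <= m)%N -> lim_mass E - e <= full_mass p m E.
Proof.
move=> e0; have wp0 : 0 < wmin ^+ p by rewrite exprn_gt0.
have [m0 m0P] := lim_mass_adherent E (mulr_gt0 wp0 e0); exists m0 => m mm.
have := full_mass_defect p m E; have := mass_anti E mm.
have := lim_mass_le (m + p) E; have := lim_mass_le m E => Lm Lmp mm0 defect.
have : wmin ^+ p * (mass m E - full_mass p m E) <= wmin ^+ p * e by lra.
by rewrite ler_pM2l//; lra.
Qed.

(** * Transport of packings by the similarities *)

Definition packs rho E (v : R) :=
  exists2 B, finite_packing rho (F `&` E) B & v <= packing_sum t B.

Lemma packs0 rho E : packs rho E 0.
Proof.
by exists (BallFamily (of_void _) (of_void _)); [exact: finite_packing_void|exact: packing_sum_ge0].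
Qed.

(** Copying by [S i] multiplies the sum by [w i]. Balls in different pieces stay disjoint because
    their radii, contracted strictly, are below [gap / 2]. *)
Lemma packs_glue rho E (v : I -> R) : rho <= gap / 2 ->
  (forall i, packs rho (S i @^-1` E) (v i)) ->
  packs (cmax * rho) E (\sum_i w i * v i).
Proof.
move=> rhog /(_ _)/cid2-/all_sig2[B Bpack vB].
pose G := @BallFamily R n {i : I & index (B i)}
  (fun ij => S (tag ij) (center (tagged ij))) (fun ij => c (tag ij) * radius (tagged ij)).
exists G.
  split=> [[i j]|[i j] [k l] ijkl] /=.
    have [[Fx Ex] r0 rrho] := (Bpack i).1 j; split=> //.
    - by split=> //; exact: SF.
    - by rewrite mulr_gt0.
    - by apply: ler_pM => //; exact: ltW.
  have [[Fx Ex] rj0 rjrho] := (Bpack i).1 j.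
  have [[Fy Ey] rl0 rlrho] := (Bpack k).1 l.
  have [ik|ik] := eqVneq i k.
    subst k; rewrite SE -mulrDr ltr_pM2l//; apply: (Bpack i).2.
    by apply: contra ijkl => /eqP->.
  apply: lt_le_trans (gapP Fx Fy ik); rewrite (splitr gap).
  by apply: ltrD; apply: lt_le_trans rhog; [apply: lt_le_trans rjrho|apply: lt_le_trans rlrho];
    rewrite gtr_pMl.
apply: (@le_trans _ _ (\sum_i w i * packing_sum t (B i))).
  by apply: ler_sum => i _; rewrite ler_wpM2l.
rewrite le_eqVlt; apply/orP; left; apply/eqP.
rewrite /packing_sum; under eq_bigr do rewrite mulr_sumr.
rewrite sig_big_dep/=; apply: eq_bigr => -[i j] _ /=.
have [_ r0 _] := (Bpack i).1 j.
by rewrite ball_diamZ powRM ?ball_diam_ge0// ltW.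
Qed.

(** Iterates [packs_glue], with the given packing in the full cylinders and the empty packing in the
    others. *)
Lemma packs_full_mass rho p m E b : rho <= gap / 2 -> 0 <= rho ->
  (forall E', mass p E' = 1 -> packs rho E' b) ->
  packs (cmax ^+ m * rho) E (full_mass p m E * b).
Proof.
move=> rhog rho0 base; elim: m E => [|m IH] E.
  rewrite expr0 mul1r [full_mass _ _ _]/=; case: eqVneq => [pE|_].
    by rewrite mul1r; exact: base.
  by rewrite mul0r; exact: packs0.
rewrite exprS -mulrA /= mulr_suml; under eq_bigr do rewrite -mulrA.
apply: packs_glue => // ; apply: le_trans rhog.
by rewrite ler_piMl// exprn_ile1// ltW.
Qed.

(** Every piece receives a copy of the same packing; as the weights sum to 1, the radii shrink while
    the sum is preserved. *)
Lemma packs_refine rho m v : rho <= gap / 2 -> 0 <= rho ->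
  packs rho setT v -> packs (cmax ^+ m * rho) setT v.
Proof.
move=> rhog rho0 rhov; elim: m => [|m IH]; first by rewrite expr0 mul1r.
rewrite exprS -mulrA -[v]mul1r -sumct mulr_suml.
apply: packs_glue => [|i]; last by rewrite preimage_setT.
by apply: le_trans rhog; rewrite ler_piMl// exprn_ile1// ltW.
Qed.

(* The centres of [B] are moved into [E], which costs an arbitrarily small factor
   on the radii. *)
Lemma packs_mass1 rho B b : finite_packing rho F B -> 0 <= b -> b < packing_sum t B ->
  exists p, forall E, mass p E = 1 -> packs rho E b.
Proof.
move=> [Bball Bsep] b0 bB; have sB0 := le_lt_trans b0 bB.
(* The radii will be multiplied by [1 - l]. Since [t <= N], Bernoulli's inequality bounds
   [(1 - l) ^ t] below by [1 - N * l], hence by [b / packing_sum t B]. *)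
pose N := (Num.bound t).+1.
have tN : t <= N%:R by rewrite (le_trans (ltW (archi_boundP t0)))// ler_nat.
pose l := (1 - b / packing_sum t B) / N.+1%:R.
have bs1 : b / packing_sum t B < 1 by rewrite ltr_pdivrMr// mul1r.
have bs0 : 0 <= b / packing_sum t B by rewrite divr_ge0// ltW.
have l0 : 0 < l by rewrite divr_gt0// subr_gt0.
have Nl : N.+1%:R * l = 1 - b / packing_sum t B by rewrite mulrC divfK.
have l1 : l < 1.
  have : 2 * l <= N.+1%:R * l by rewrite ler_wpM2r ?ler_nat// ltW.
  lra.
clearbody l.
have bern k : 1 - k%:R * l <= (1 - l) ^+ k.
  elim: k => [|k IH]; first by rewrite mul0r subr0 expr0.
  rewrite exprS; apply: le_trans (_ : _ <= (1 - l) * (1 - k%:R * l)) _.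
    have : 0 <= k%:R * l * l by rewrite !mulr_ge0 ?(ltW l0).
    rewrite -natr1; lra.
  by rewrite ler_wpM2l// subr_ge0 ltW.
have bq : b <= (1 - l) `^ t * packing_sum t B.
  rewrite -ler_pdivrMr//; apply: (@le_trans _ _ ((1 - l) ^+ N)).
    apply: le_trans (bern N); move: Nl; rewrite -natr1 mulrDl mul1r; lra.
  rewrite -powR_mulrn ?subr_ge0 ?(ltW l1)// ger_powR//.
  by rewrite subr_gt0 l1/= gerBl ltW.
(* Centres move by at most [d], which the loss [l * radius j] of each radius compensates. *)
have [d d0 dle] : exists2 d, 0 < d & forall j, d <= l * radius (b := B) j.
  by apply: finite_pos_lower_bound => j; have [_ ? _] := Bball j; rewrite mulr_gt0.
have [p pD] := expr_mul_small D (introT andP (conj (ltW cmax_gt0) cmax1)) d0.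
exists p => E pE.
have /choice[y yP] : forall j : index B, exists y,
    [/\ F y, E y & edist (center j) y <= cmax ^+ p * D].
  by move=> j; apply: mass1_dense => //; have [] := Bball j.
have sep_y (j k : index B) : j != k ->
    (1 - l) * radius j + (1 - l) * radius k < edist (y j) (y k).
  move=> jk; have [_ _ yj] := yP j; have [_ _ yk] := yP k; rewrite edistC in yk.
  have := edist_quadrilateral (center j) (center k) (y j) (y k).
  have := Bsep j k jk; have := dle j; have := dle k; lra.
exists (BallFamily y (fun j : index B => (1 - l) * radius j)).
  split=> [j|] /=; last exact: sep_y.
  have [Fy Ey _] := yP j; have [_ r0 rrho] := Bball j; split=> //.
    by rewrite mulr_gt0// subr_gt0.
  by apply: le_trans rrho; rewrite ler_piMl ?gerBl ?ltW.
apply: le_trans bq _; rewrite /packing_sum mulr_sumr le_eqVlt; apply/orP; left.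
apply/eqP/eq_bigr => j _ /=; have [_ r0 _] := Bball j.
by rewrite ball_diamZ powRM ?subr_ge0 ?ball_diam_ge0// ltW.
Qed.

(** * Bounds at a fixed scale *)

(** The balls of half radius are more than [d] apart, so for large [m] their masses add up to at
    most 1; [mass_ball_ge] bounds each mass below. The constant turns [cmin / D * (r / 2)] into
    [2 * r]. *)
Lemma packing_sum_bounded rho B : rho <= gap / 2 -> finite_packing rho F B ->
  packing_sum t B <= (4 * D / cmin) `^ t.
Proof.
move=> rhog [Bball Bsep].
have r0 (j : index B) : 0 < radius j by have [] := Bball j.
have [d d0 dle] := finite_pos_lower_bound r0.
have [m mD] := expr_mul_small D (introT andP (conj (ltW cmax_gt0) cmax1)) d0.
have : \sum_(j : index B) mass m (eball (center j) (radius j / 2)) <= 1.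
  apply: sum_mass_separated => j k x y jk Fx Fy; rewrite /eball/= => xj yk.
  rewrite edistC in yk; have := edist_quadrilateral (center j) (center k) x y.
  have := Bsep j k jk; have := dle j; have := dle k; lra.
move=> /(ler_wpM2l (powR_ge0 (4 * D / cmin) t)); rewrite mulr1; apply: le_trans.
rewrite mulr_sumr; apply: ler_sum => j _; have [Fx rj0 rrho] := Bball j.
have rD : radius j / 2 <= D by move: rrho rhog gapD; lra.
have Dc0 : 0 <= 4 * D / cmin by rewrite divr_ge0 ?mulr_ge0// ltW.
apply: le_trans (ler_wpM2l (powR_ge0 _ _) (mass_ball_ge m Fx _ rD)); last by rewrite divr_gt0.
rewrite -powRM//; last by rewrite mulr_ge0 ?divr_ge0// ltW.
have -> : 4 * D / cmin * (cmin / D * (radius j / 2)) = 2 * radius j.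
  by field; rewrite !gt_eqF.
by rewrite ge0_ler_powR// ?nnegrE ?ball_diam_ge0 ?mulr_ge0 ?ball_diam_le// ltW.
Qed.

(** In dimension 0 all points coincide, so the gap allows only one map, and its equation
    [c i0 ^ t = 1] forces [t = 0]. *)
Lemma dim_gt0 : 0 < t -> (0 < n)%N.
Proof.
move=> t_gt0; rewrite lt0n; apply/negP => /eqP n0.
have [x Fx] := F0; pose i0 := index_inhabited.
have ii0 i : i = i0.
  apply/eqP/negPn/negP => ii0; have := gapP Fx Fx ii0.
  rewrite /edist big1 ?sqrtr0 ?leNgt ?gap0// => k _.
  by have := ltn_ord k; rewrite [X in (_ < X)%N]n0.
have : c i0 `^ t = 1.
  by rewrite -sumct (bigD1 i0)//= big1 ?addr0// => i; rewrite (ii0 i) eqxx.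
move/eqP; rewrite powR_eq1 (gt_eqF t_gt0) (lt_eqF (c_lt1 i0)).
by rewrite ltNge (ltW (c_gt0 i0)).
Qed.

Lemma packing_delta_gt0 d : 0 < d -> (0 < packing_delta t d F)%E.
Proof.
move=> d0; have [x Fx] := F0; have d20 : 0 < d / 2 by rewrite divr_gt0.
pose B := @BallFamily R n unit (fun=> x) (fun=> d / 2).
have BF : finite_packing (d / 2) F B by split=> [|[] []].
apply: lt_le_trans (packing_sum_le_delta t d0 BF).
rewrite lte_fin /packing_sum (bigD1 tt)//= big1 ?addr0; last by case.
have [t_0|t_neq0] := eqVneq t 0; first by rewrite t_0 powRr0.
by rewrite powR_gt0// /ball_diam dim_gt0 ?mul1r ?mulr_gt0// lt_neqAle eq_sym t_neq0.
Qed.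

Lemma packing_delta_bounded d : 0 < d -> d <= gap ->
  (packing_delta t d F <= ((4 * D / cmin) `^ t)%:E)%E.
Proof.
move=> d0 dgap; apply: packing_delta_le => // B BF; rewrite lee_fin.
by apply: packing_sum_bounded BF; rewrite ler_pM2r.
Qed.

(** * Pre-measure, measure and dimension of the attractor *)

Let exists_scale rho d : 0 < d -> exists m, cmax ^+ m * rho <= d / 2.
Proof. by move=> d0; apply: expr_mul_small; rewrite ?divr_gt0// ltW. Qed.

(** By [packs_refine], a packing at scale [d] yields one at any smaller scale with at least the same
    sum. *)
Lemma packing_premeasure_delta d : 0 < d -> d <= gap ->
  packing_premeasure t F = packing_delta t d F.
Proof.
move=> d0 dgap; apply/eqP; rewrite eq_le packing_premeasure_le//=.
apply: le_packing_premeasure => d' d'0; apply: packing_delta_le => // B BF.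
have [m mle] := exists_scale (d / 2) d'0.
have d2gap : d / 2 <= gap / 2 by rewrite ler_pM2r.
have d20 : 0 <= d / 2 by rewrite divr_ge0// ltW.
have Bpacks : packs (d / 2) setT (packing_sum t B) by exists B => //; rewrite setIT.
have [B'] := packs_refine m d2gap d20 Bpacks; rewrite setIT => B'F BB'.
apply: (@le_trans _ _ (packing_sum t B')%:E); first by rewrite lee_fin.
by apply: packing_sum_le_delta => //; apply: finite_packing_mono B'F.
Qed.

Lemma lim_mass_packing_premeasure E b : 0 <= b ->
  (b%:E < packing_delta t gap F)%E -> ((b * lim_mass E)%:E <= packing_premeasure t E)%E.
Proof.
move=> b0 bF.
have [B BF bB] : exists2 B, finite_packing (gap / 2) F B & b < packing_sum t B.
  apply: contrapT => nB; move: bF; rewrite ltNge => /negP; apply.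
  apply: packing_delta_le => // B BF; rewrite lee_fin leNgt; apply/negP => bB.
  by apply: nB; exists B.
have [p pP] := packs_mass1 BF b0 bB.
have key e : 0 < e -> ((b * (lim_mass E - e))%:E <= packing_premeasure t E)%E.
  move=> e0; apply: le_packing_premeasure => d d0.
  have [m0 m0P] := full_mass_lim p E e0.
  have [m1 m1P] := exists_scale (gap / 2) d0.
  have gap20 : 0 <= gap / 2 by rewrite divr_ge0// ltW.
  (* Generation [m0] secures enough full mass, [m1] makes the balls small enough. *)
  have [B' B'E] := packs_full_mass (maxn m0 m1) E (lexx _) gap20 pP.
  move=> B'sum; apply: (@le_trans _ _ (packing_sum t B')%:E).
    rewrite lee_fin; apply: le_trans B'sum; rewrite mulrC ler_wpM2r//.
    by apply: m0P; exact: leq_maxl.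
  apply: packing_sum_le_delta => //; apply: finite_packing_mono B'E => [|x []//].
  apply: le_trans m1P; rewrite ler_wpM2r//.
  by apply: ler_wiXn2l (leq_maxr _ _); rewrite ltW.
apply/lee_addgt0Pr => e e0.
(* The denominator is [b + 1] because [b] may be 0. *)
have eb0 : 0 < e / (b + 1) by rewrite divr_gt0// ltr_wpDl.
apply: le_trans (leeD2r e%:E (key _ eb0)); rewrite -EFinD lee_fin.
have : b * (e / (b + 1)) <= e.
  by rewrite mulrCA ger_pMr// ler_pdivrMr ?mul1r ?lerDl// ltr_wpDl.
rewrite mulrBr; lra.
Qed.

Lemma packing_measure_premeasure : compact F ->
  packing_measure t F = packing_premeasure t F.
Proof.
move=> Fcpt; apply/eqP; rewrite eq_le packing_measure_le/=.
rewrite (packing_premeasure_delta gap0 (lexx _)).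
apply/ereal_infP => _ [G FG <-].
have sum0 : (0 <= \sum_(0 <= i <oo) packing_premeasure t (G i))%E.
  by apply: nneseries_ge0 => *; exact: packing_premeasure_ge0.
have key b : 0 <= b -> (b%:E < packing_delta t gap F)%E ->
    (b%:E <= \sum_(0 <= i <oo) packing_premeasure t (G i))%E.
  move=> b0 bF; apply/lee_addgt0Pr => e e0.
  have eb0 : 0 < e / (b + 1) by rewrite divr_gt0// ltr_wpDl.
  have [N NG] := lim_mass_cover Fcpt FG eb0.
  apply: (@le_trans _ _ ((\sum_(i < N) b * lim_mass (G i))%:E + e%:E)%E).
    rewrite -EFinD lee_fin -mulr_sumr.
    have := ler_wpM2l b0 NG; rewrite mulrBr mulr1.
    have : b * (e / (b + 1)) <= e.
      by rewrite mulrCA ger_pMr// ler_pdivrMr ?mul1r ?lerDl// ltr_wpDl.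
    lra.
  rewrite leeD2r//.
  apply: le_trans (nneseries_lim_ge N _); last by move=> *; exact: packing_premeasure_ge0.
  rewrite -sumEFin big_mkord; apply: lee_sum => i _.
  exact: lim_mass_packing_premeasure.
have Ffin : packing_delta t gap F \is a fin_num.
  rewrite ge0_fin_numE ?packing_delta_ge0//.
  exact: le_lt_trans (packing_delta_bounded gap0 (lexx _)) (ltry _).
apply/lee_subgt0Pr => e e0; rewrite -(fineK Ffin) -EFinB.
have [b0|b0] := leP 0 (fine (packing_delta t gap F) - e); last first.
  by apply: le_trans sum0; rewrite lee_fin ltW.
by apply: key => //; rewrite -[ltRHS](fineK Ffin) lte_fin gtrBl.
Qed.

(** For [s > t], a factor [diam ^ (s - t)] splits off and is small at small scales, while the sums
    of [t]-th powers stay bounded. For [s < t], the [s]-measure dominates the positive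
    [t]-measure. *)
Lemma packing_dim_eq : compact F -> packing_dim F = t.
Proof.
move=> Fcpt; pose C := (4 * D / cmin) `^ t.
have C0 : 0 < C by rewrite powR_gt0// divr_gt0// mulr_gt0.
have above s : t < s -> packing_measure s F = 0%E.
  move=> ts; apply/eqP; rewrite eq_le packing_measure_ge0 andbT.
  apply: le_trans (packing_measure_le _ _) _; apply/lee_addgt0Pr => e e0.
  rewrite add0e; have st0 : 0 < s - t by rewrite subr_gt0.
  (* Chosen so that [d ^ (s - t) <= e / C], within the scales where [C] bounds the sums. *)
  pose d := Num.min gap ((e / C) `^ (s - t)^-1).
  have d0 : 0 < d by rewrite lt_min gap0 powR_gt0// divr_gt0.
  apply: le_trans (packing_premeasure_le _ _ d0) _.
  apply: packing_delta_le => // B BF; rewrite lee_fin.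
  have sumB : packing_sum t B <= C.
    by apply: packing_sum_bounded BF; rewrite ler_pM2r// ge_min lexx.
  apply: (@le_trans _ _ (e / C * packing_sum t B)); last first.
    by rewrite mulrAC ler_pdivrMr// ler_wpM2l// ltW.
  rewrite /packing_sum mulr_sumr; apply: ler_sum => j _.
  have [_ r0 rd] := BF.1 j.
  have x0 := ball_diam_ge0 (n := n) (ltW r0).
  rewrite -{1}(subrK t s) powRD; last by rewrite subrK gt_eqF// (le_lt_trans t0).
  rewrite ler_wpM2r ?powR_ge0//.
  have -> : e / C = ((e / C) `^ (s - t)^-1) `^ (s - t).
    by rewrite -powRrM mulVf ?gt_eqF// powRr1// divr_ge0 ?ltW.
  rewrite ge0_ler_powR ?nnegrE ?powR_ge0 ?(ltW st0)//.
  apply: le_trans (ball_diam_le (ltW r0)) _; rewrite mulrC -ler_pdivlMr//.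
  by apply: le_trans rd _; rewrite ler_pM2r// ge_min lexx orbT.
have below s : 0 <= s -> packing_measure s F = 0%E -> t <= s.
  move=> s0 sF; rewrite leNgt; apply/negP => st.
  have := packing_measure_mono (s := t) (t := s) F
    (fun G => packing_premeasure_antimono G s0 (ltW st)).
  rewrite sF packing_measure_premeasure// (packing_premeasure_delta gap0 (lexx _)).
  by rewrite leNgt packing_delta_gt0.
apply/eqP; rewrite eq_le; apply/andP; split.
  apply/ler_addgt0Pr => e e0; apply: ge_inf; first by exists 0 => s [].
  split; first by rewrite addr_ge0// ltW.
  by apply: above; rewrite ltrDl.
apply: lb_le_inf; last by move=> s [s0 sF]; exact: below.
exists (t + 1); split; first by rewrite addr_ge0.
by apply: above; rewrite ltrDl.
Qed.

Lemma separated_ifs_packing_measure d : compact F -> 0 < d -> d <= gap ->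
  let s := packing_dim F in
  [/\ (0 < packing_measure s F)%E,
      packing_measure s F = packing_premeasure s F,
      packing_premeasure s F = packing_delta s d F &
      (packing_delta s d F < +oo)%E].
Proof.
move=> Fcpt d0 dgap; rewrite packing_dim_eq//=.
rewrite packing_measure_premeasure// (packing_premeasure_delta d0 dgap).
split=> //; first exact: packing_delta_gt0.
exact: le_lt_trans (packing_delta_bounded d0 dgap) (ltry _).
Qed.

End SeparatedIFS.

(** * Similarity dimension, gap and diameter *)

(** Intermediate value theorem: the sum is at least 1 at exponent 0, and at most [cmax ^+ m * #|I|],
    hence at most 1, at a large integer [m]. *)
Lemma similarity_dimension (R : realType) (I : finType) (c : I -> R) (cmax : R) :
  I -> (forall i, 0 < c i) -> (forall i, c i <= cmax) -> cmax < 1 ->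
  exists2 t, 0 <= t & \sum_i c i `^ t = 1.
Proof.
move=> i0 c0 le_cmax cmax1.
have cmax01 : 0 <= cmax < 1 by rewrite cmax1 (le_trans (ltW (c0 i0))).
pose f t := \sum_i expR (t * ln (c i)).
have fE t : f t = \sum_i c i `^ t.
  by apply: eq_bigr => i _; rewrite /powR gt_eqF.
have cont_f : continuous f.
  move=> x; apply: (cvg_big (op := +%R)) => [|i _]; first exact: add_continuous.
  apply: continuous_cvg; first exact: continuous_expR.
  by apply: cvgM; [exact: cvg_id|exact: cvg_cst].
have f0 : 1 <= f 0.
  rewrite fE (bigD1 i0)//= powRr0 lerDl sumr_ge0// => i _; exact: powR_ge0.
have [m mle] := expr_mul_small #|I|%:R cmax01 ltr01.
have fm : f m%:R <= 1.
  rewrite fE; apply: le_trans mle; rewrite mulrC mulr_natl -sumr_const.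
  apply: ler_sum => i _; rewrite powR_mulrn ?(ltW (c0 i))//.
  by rewrite lerXn2r ?nnegrE// (le_trans (ltW (c0 i))).
have [|t] := @IVT _ f 0 m%:R 1 (ler0n _ m) (continuous_subspaceT cont_f).
  by rewrite ge_min le_max fm f0 orbT.
by rewrite in_itv/= fE => /andP[t0 _] ft; exists t.
Qed.

Section CompactAttractor.
Context {R : realType} {n : nat} {I : finType}.
Context {S : I -> 'rV[R]_n -> 'rV[R]_n} {F : set 'rV[R]_n} {c : I -> R}.
Context (SE : forall i x y, edist (S i x) (S i y) = c i * edist x y).
Context (c1 : forall i, c i <= 1).
Context (F0 : F !=set0) (Fcpt : compact F).

Let FF0 : F `*` F !=set0.
Proof. by have [x Fx] := F0; exists (x, x). Qed.

Let cont_edist i j :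
  continuous (fun p : 'rV[R]_n * 'rV[R]_n => edist (S i p.1) (S j p.2)).
Proof.
apply: edist_lipschitz_continuous => p q.
have := edist_quadrilateral (S i p.1) (S j p.2) (S i q.1) (S j q.2).
have := edist_quadrilateral (S i q.1) (S j q.2) (S i p.1) (S j p.2).
rewrite (edistC (S i q.1) (S i p.1)) (edistC (S j q.2) (S j p.2)) !SE.
have := ler_wpM2r (edist_ge0 p.1 q.1) (c1 i).
have := ler_wpM2r (edist_ge0 p.2 q.2) (c1 j).
rewrite !mul1r ler_norml => ? ? ? ?; apply/andP; split; lra.
Qed.

(** For [i != j] the distance between the two images attains its minimum on the compact product, and
    disjointness makes it positive. *)
Lemma strong_separation_gap : trivIset setT (fun i => S i @` F) ->
  exists2 gap, 0 < gap &
    forall i j x y, F x -> F y -> i != j -> gap <= edist (S i x) (S j y).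
Proof.
move=> sepF.
have /choice[g gP] : forall ij : I * I, exists g, 0 < g /\
    (forall x y, F x -> F y -> ij.1 != ij.2 -> g <= edist (S ij.1 x) (S ij.2 y)).
  move=> [i j]/=; have [ij|ij] := eqVneq i j; first by exists 1; rewrite ltr01.
  have [[x y] /set_mem[Fx Fy] xymin] := compact_EVT_min FF0 (compact_setX Fcpt Fcpt)
    (continuous_subspaceT (@cont_edist i j)).
  exists (edist (S i x) (S j y)); split.
    rewrite lt_neqAle edist_ge0 andbT eq_sym; apply/negP => /eqP/edist_eq0 xy.
    move/eqP: ij; apply; apply: (sepF i j) => //.
    by exists (S i x); split; [exists x|exists y].
  by move=> x' y' Fx' Fy' _; apply: (xymin (x', y')); apply/mem_set.
have [gap gap0 gaple] := finite_pos_lower_bound (fun ij => (gP ij).1).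
exists gap => // i j x y Fx Fy ij.
by apply: le_trans (gaple (i, j)) _; exact: (gP (i, j)).2.
Qed.

End CompactAttractor.

Lemma compact_edist_bounded (R : realType) (n : nat) (F : set 'rV[R]_n) :
  F !=set0 -> compact F -> exists D, forall x y, F x -> F y -> edist x y <= D.
Proof.
move=> [x0 Fx0] Fcpt.
have cont_e : continuous (fun p : 'rV[R]_n * 'rV[R]_n => edist p.1 p.2).
  apply: edist_lipschitz_continuous => p q.
  have := edist_quadrilateral p.1 p.2 q.1 q.2.
  have := edist_quadrilateral q.1 q.2 p.1 p.2.
  rewrite (edistC q.1 p.1) (edistC q.2 p.2) ler_norml; lra.
have FF0 : F `*` F !=set0 by exists (x0, x0).
have [p _ pmax] := compact_EVT_max FF0 (compact_setX Fcpt Fcpt) (continuous_subspaceT cont_e).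
exists (edist p.1 p.2) => x y Fx Fy.
by apply: (pmax (x, y)); apply/mem_set.
Qed.

Theorem theorem5p2 (R : realType) (n : nat) (I : finType)
    (S : I -> 'rV[R]_n -> 'rV[R]_n) (F : set 'rV[R]_n)
    (hS : forall i, contracting_similarity (S i))
    (hF : is_attractor S F)
    (hSSC : strong_separation S F)
    (s : R) (hs : s = packing_dim F) :
  exists2 delta0 : R, 0 < delta0 &
    forall delta : R, 0 < delta < delta0 ->
      [/\ (0 < packing_measure s F)%E,
          packing_measure s F = packing_premeasure s F,
          packing_premeasure s F = packing_delta s delta F &
          (packing_delta s delta F < +oo)%E].
Proof.
have [F0 Fcpt FE] := hF.
have /choice[c cP] : forall i, exists c, 0 < c < 1 /\
    forall x y, edist (S i x) (S i y) = c * edist x y.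
  by move=> i; have [c c01 cE] := hS i; exists c.
have c0 i : 0 < c i by have [/andP[]] := cP i.
have c1 i : c i < 1 by have [/andP[]] := cP i.
have SE i := (cP i).2.
have [i0] : inhabited I.
  by have [x] := F0; rewrite FE => -[i _ _].
have [cmin cmin0 cmin_le] := finite_pos_lower_bound c0.
have [d d0 d_le] : exists2 d, 0 < d & forall i, d <= 1 - c i.
  by apply: finite_pos_lower_bound => i; rewrite subr_gt0.
have le_cmax i : c i <= 1 - d by rewrite lerBrDr addrC -lerBrDr.
have cmax1 : 1 - d < 1 by rewrite gtrBl.
have [t t0 sumct] := similarity_dimension i0 c0 le_cmax cmax1.
have [gap gap0 gapP] := strong_separation_gap SE (fun i => ltW (c1 i)) F0 Fcpt hSSC.
have [D0 D0P] := compact_edist_bounded F0 Fcpt.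
(* The maximum keeps [D] positive and above [gap] even when [F] is a single point. *)
pose D := Num.max gap D0.
have gapD : gap <= D by rewrite le_max lexx.
have diamF x y : F x -> F y -> edist x y <= D.
  by move=> Fx Fy; rewrite le_max D0P ?orbT.
rewrite hs; exists gap => // delta /andP[delta0 /ltW delta_gap].
exact: (separated_ifs_packing_measure cmin0 cmin_le le_cmax cmax1 SE F0 FE gap0
  gapP gapD diamF t0 sumct Fcpt delta0 delta_gap).
Qed.
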